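(* Let $G$ be a non-cyclic abelian group of (finite) order $n$, and let $\mathbb{Z}_n$ be the cyclic group of order $n$. Write $n=2^t\cdot l$ with $t\geq 0$ and $\gcd(2,l)=1$. Then $$m(G)\geq\frac{3+t}{2+t}\, m(\mathbb{Z}_n).$$
   Context: For a finite group $G$, $m(G)=\sum_{a\in G}\frac{1}{o(a)}$, where $o(a)$ denotes the order of the element $a$ in $G$. *)

(* Defs.v *)
From mathcomp Require Import all_boot all_order all_algebra all_fingroup all_solvable.

Set Implicit Arguments.
Unset Strict Implicit.
Unset Printing Implicit Defensive.

Import GRing.Theory.
Local Open Scope ring_scope.

Definition m (gT : finGroupType) (G : {group gT}) : rat :=
  \sum_(a in G) 1 / #[a]%g%:R.

(* Main.v *)
Require Import Defs.
From mathcomp Require Import all_boot all_order all_algebra all_fingroup all_solvable.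
From mathcomp Require Import ring lra.

Set Implicit Arguments.
Unset Strict Implicit.
Unset Printing Implicit Defensive.

Import Order.TTheory GRing.Theory Num.Theory.
Local Open Scope ring_scope.

(** Write C for the cyclic group of order n. An abelian group G is the direct
    product of its p-part 'O_p(G) and its p'-part 'O_p^'(G), whose orders are
    coprime, so m is multiplicative along this decomposition ([m_pcoreC]), for
    G as for C. It remains to compare m on groups of the same order, factor by
    factor.

    For a group P of order p ^ k, take a maximal subgroup M. It has index p,
    and the p ^ k - p ^ (k - 1) elements of P outside M have order at most
    p ^ k, so m P >= m M + (1 - 1 / p). By induction
    m P >= 1 + k (1 - 1 / p), and for cyclic P this is an equality, because
    all elements outside the only maximal subgroup are generators. Hence C
    minimizes m among the nilpotent groups of order n
    ([m_nilpotent_ge_cyclic]).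

    If P is not cyclic, elements have order at most p ^ (k - 1), and the same
    step gains p - 1 instead of 1 - 1 / p. To repeat it, M must not be cyclic
    either.
    A non-cyclic abelian G has, for some prime p, an elementary abelian
    subgroup E of order p ^ 2 in 'O_p(G); choosing every M above E keeps it
    non-cyclic ([m_noncyclic_pgroup_ge]). This yields the factor
    (3 + t) / (2 + t) on the p-part alone ([pgroup_ratio]), while the p'-part
    contributes a factor at least 1. *)

(** * Splitting the sum *)

Lemma order_invr_ge (gT : finGroupType) (x : gT) (d : nat) :
  (#[x]%g <= d)%N -> d%:R^-1 <= 1 / #[x]%g%:R :> rat.
Proof.
move=> le_xd; have x_gt0 := order_gt0 x.
by rewrite div1r lef_pV2 ?ler_nat // posrE ltr0n // (leq_trans x_gt0).
Qed.

Lemma m_setD (gT : finGroupType) (M G : {group gT}) : M \subset G ->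
  m G = m M + \sum_(x in G :\: M) 1 / #[x]%g%:R.
Proof. by move=> sMG; rewrite {1}/m (big_setID M) /= (setIidPr sMG). Qed.

Lemma m_ge1 (gT : finGroupType) (G : {group gT}) : 1 <= m G.
Proof.
rewrite (m_setD (sub1G G)) {1}/m big_set1 order1 divr1 lerDl.
by apply: sumr_ge0 => x _; rewrite div1r invr_ge0 ler0n.
Qed.

Lemma m_setD_ge (gT : finGroupType) (M G : {group gT}) (d : nat) :
    M \subset G -> (forall x, x \in G :\: M -> #[x]%g <= d)%N ->
  m M + #|G :\: M|%:R / d%:R <= m G.
Proof.
move=> sMG le_d; rewrite (m_setD sMG) lerD2l mulrC mulr_natr -sumr_const.
by apply: ler_sum => x /le_d; apply: order_invr_ge.
Qed.

(** Each element of G is uniquely x * y with x in K and y in H; these commute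
    and have coprime orders, so the order of x * y is the product. *)
Lemma m_dprod (gT : finGroupType) (K H G : {group gT}) :
  (K \x H = G)%g -> coprime #|K| #|H| -> m G = m K * m H.
Proof.
case/dprodP=> _ defG cKH tiKH coKH.
have inj_mul : {in setX K H &, injective (fun u : gT * gT => u.1 * u.2)%g}.
  move=> [x y] [x' y'] /setXP[/= Kx Hy] /setXP[/= Kx' Hy'] eq_xy.
  (* The quotient of the two K-components is one of H-components. *)
  have: (x'^-1 * x)%g \in K :&: H.
    rewrite inE groupM ?groupV //=.
    have ->: (x'^-1 * x = y' * y^-1)%g.
      by apply: (mulgI x'); rewrite mulKVg mulgA -eq_xy mulgK.
    by rewrite groupM ?groupV.
  rewrite tiKH => /set1P/(canRL (mulKVg _)); rewrite mulg1 => eq_x.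
  by move: eq_xy; rewrite eq_x => /mulgI->.
have imG : G :=: [set (u.1 * u.2)%g | u in setX K H].
  apply/setP=> g; rewrite -defG; apply/mulsgP/imsetP.
    by case=> x y Kx Hy ->; exists (x, y); rewrite // inE Kx.
  by case=> [[x y] /setXP[Kx Hy] ->]; exists x y.
rewrite /m imG big_imset //= big_distrlr /= pair_big.
apply: eq_big => [[x y]|[x y] /setXP[Kx Hy]] /=; first by rewrite inE.
rewrite orderM ?natrM; first by rewrite mulf_div mul1r.
  exact/esym/(centsP cKH).
by apply: coprime_dvdl (order_dvdG Kx) (coprime_dvdr (order_dvdG Hy) coKH).
Qed.

(** * Prime power order *)

(** The induction step for p-groups of order p ^ k: a maximal subgroup has
    index p, which also fixes how many elements lie outside it. Prescribing a
    subgroup H inside M allows the induction to stay above a fixed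
    non-cyclic H. *)
Lemma pgroup_index_p_exists (gT : finGroupType) (p k : nat) (H P : {group gT}) :
    prime p -> #|P| = (p ^ k.+1)%N -> H \proper P ->
  exists M : {group gT}, [/\ H \subset M, M \subset P, #|M| = (p ^ k)%N
    & #|P :\: M| = (p ^ k * (p - 1))%N].
Proof.
move=> p_pr oP /properP[sHP [x Px notHx]].
have pP : (p.-group P)%g by rewrite /pgroup oP pnatX pnat_id.
case: (maximal_exists sHP) => [eqHP | [M maxM sHM]].
  by rewrite eqHP Px in notHx.
have sMP := proper_sub (maxgroupp maxM).
have oM : #|M| = (p ^ k)%N.
  apply/eqP; rewrite -(eqn_pmul2r (prime_gt0 p_pr)) -expnSr -oP.
  by rewrite -(Lagrange sMP) (p_maximal_index pP maxM).
exists M; split=> //.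
by rewrite cardsD (setIidPr sMP) oM oP expnSr mulnBr muln1.
Qed.

Lemma m_pgroup_ge (gT : finGroupType) (p k : nat) (P : {group gT}) :
  prime p -> #|P| = (p ^ k)%N -> 1 + k%:R * (1 - p%:R^-1) <= m P.
Proof.
move=> p_pr; have q_neq0 : p%:R != 0 :> rat by rewrite pnatr_eq0 -lt0n prime_gt0.
elim: k P => [|k IH] P oP; first by rewrite mul0r addr0 m_ge1.
have prP : 1%G \proper P.
  by rewrite proper1G -cardG_gt1 oP -(exp1n k.+1) ltn_exp2r ?prime_gt1.
have [M [_ sMP oM oD]] := pgroup_index_p_exists p_pr oP prP.
apply: le_trans (m_setD_ge (d := p ^ k.+1) sMP _); last first.
  by move=> x /setDP[Px _]; rewrite -oP dvdn_leq ?order_dvdG.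
rewrite oD natrM natrB ?prime_gt0 // !natrX exprS.
have ->: p%:R ^+ k * (p%:R - 1) / (p%:R * p%:R ^+ k) = 1 - p%:R^-1 :> rat.
  by field; rewrite q_neq0 expf_neq0.
by move: (IH _ oM); rewrite -[k.+1%:R]natr1; lra.
Qed.

(** The lower bound of [m_pgroup_ge] is attained: a cyclic group has only one
    subgroup of each order, so an element outside the maximal subgroup M
    generates P and contributes exactly p ^ - k.+1. *)
Lemma m_cyclic_pgroup (gT : finGroupType) (p k : nat) (P : {group gT}) :
  prime p -> cyclic P -> #|P| = (p ^ k)%N -> m P = 1 + k%:R * (1 - p%:R^-1).
Proof.
move=> p_pr; have q_neq0 : p%:R != 0 :> rat by rewrite pnatr_eq0 -lt0n prime_gt0.
elim: k P => [|k IH] P cycP oP.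
  by rewrite mul0r addr0 /m (card1_trivg oP) big_set1 order1 divr1.
have prP : 1%G \proper P.
  by rewrite proper1G -cardG_gt1 oP -(exp1n k.+1) ltn_exp2r ?prime_gt1.
have [M [_ sMP oM oD]] := pgroup_index_p_exists p_pr oP prP.
rewrite (m_setD sMP) (IH _ (cyclicS sMP cycP) oM).
rewrite (eq_bigr (fun=> (p%:R ^+ k.+1)^-1)); last first.
  move=> x /setDP[Px notMx]; rewrite div1r -natrX; congr (_%:R^-1).
  have: (#[x]%g %| p ^ k.+1)%N by rewrite -oP order_dvdG.
  case/(dvdn_pfactor _ _ p_pr)=> j; rewrite leq_eqVlt => /predU1P[-> // | le_jk ox].
  case/negP: notMx; rewrite -cycle_subG -(cardSg_cyclic cycP) ?cycle_subG //.
  by rewrite -orderE ox oM dvdn_exp2l.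
rewrite sumr_const -[_^-1 *+ _]mulr_natr oD natrM natrB ?prime_gt0 // natrX exprS -natr1.
by field; rewrite q_neq0 expf_neq0.
Qed.

Lemma order_noncyclic_pgroup (gT : finGroupType) (p k : nat) (P : {group gT}) :
    prime p -> ~~ cyclic P -> #|P| = (p ^ k.+1)%N ->
  {in P, forall x, #[x]%g <= p ^ k}%N.
Proof.
move=> p_pr ncycP oP x Px; have: (#[x]%g %| p ^ k.+1)%N by rewrite -oP order_dvdG.
case/(dvdn_pfactor _ _ p_pr)=> j; rewrite leq_eqVlt => /predU1P[-> ox | le_jk ->].
  case/cyclicP: ncycP; exists x; apply/esym/eqP.
  by rewrite eqEcard cycle_subG Px -orderE ox oP leqnn.
by rewrite leq_exp2l ?prime_gt1.
Qed.

(** The base case P of order p ^ 2 has no element of order above p outside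
    the trivial subgroup, which accounts for (p ^ 2 - 1) / p. The step
    from order p ^ j to order p ^ j.+1 adds p ^ j (p - 1) elements of order at
    most p ^ j, hence at least p - 1 to the sum, because the larger group
    contains E and so is not cyclic. *)
Lemma m_noncyclic_pgroup_ge (gT : finGroupType) (p k : nat) (E P : {group gT}) :
    prime p -> E \subset P -> ~~ cyclic E -> #|E| = (p ^ 2)%N ->
    #|P| = (p ^ k.+2)%N ->
  1 + k.+1%:R * (p%:R - 1) + (1 - p%:R^-1) <= m P.
Proof.
move=> p_pr sEP ncycE oE oP.
have q_neq0 : p%:R != 0 :> rat by rewrite pnatr_eq0 -lt0n prime_gt0.
elim: k P sEP oP => [|k IH] P sEP oP.
all: have ncycP : ~~ cyclic P by apply: contra ncycE; apply: cyclicS.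
all: have le_ord := order_noncyclic_pgroup p_pr ncycP oP.
  apply: le_trans (m_setD_ge (sub1G P) (d := p) _); last first.
    by move=> x /setDP[/le_ord].
  rewrite cardsD (setIidPr (sub1G P)) cards1 oP natrB; last first.
    by rewrite expn_gt0 prime_gt0.
  rewrite natrX; have := m_ge1 (1%G : {group gT}).
  suff ->: (p%:R ^+ 2 - 1) / p%:R = p%:R - 1 + (1 - p%:R^-1) :> rat by lra.
  by field.
have prEP : E \proper P.
  by rewrite properEcard sEP oE oP ltn_exp2l ?prime_gt1.
have [M [sEM sMP oM oD]] := pgroup_index_p_exists p_pr oP prEP.
apply: le_trans (m_setD_ge sMP (d := p ^ k.+2) _); last first.
  by move=> x /setDP[/le_ord].
rewrite oD natrM natrB ?prime_gt0 // natrX mulrAC mulfV ?expf_neq0 // mul1r.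
by move: (IH M sEM oM); rewrite -[k.+2%:R]natr1; lra.
Qed.

(** * Nilpotent groups *)

Lemma card_pcore_nil (gT : finGroupType) (pi : nat_pred) (G : {group gT}) :
  nilpotent G -> #|'O_pi(G)%g| = (#|G|`_pi)%N.
Proof. by move=> nilG; apply: card_Hall (nilpotent_pcore_Hall pi nilG). Qed.

Lemma m_pcoreC (gT : finGroupType) (pi : nat_pred) (G : {group gT}) :
  nilpotent G -> m G = m 'O_pi(G)%G * m 'O_pi^'(G)%G.
Proof.
move=> nilG; apply: m_dprod (nilpotent_pcoreC pi nilG) _.
exact: coprime_pcoreC.
Qed.

(** Induction on the order: split off the p-part for a prime divisor p of the
    order, in both groups at once; the p'-parts again have equal orders. *)
Lemma m_nilpotent_ge_cyclic (gT rT : finGroupType) (G : {group gT})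
    (C : {group rT}) :
  nilpotent G -> cyclic C -> #|C| = #|G| -> m C <= m G.
Proof.
have [n] := ubnP #|G|; elim: n => // n IH in gT rT G C *.
rewrite ltnS => le_Gn nilG cycC oC.
have nilC : nilpotent C := abelian_nil (cyclic_abelian cycC).
have [G1 | ntG] := eqVneq (#|G|) 1%N.
  by rewrite /m (card1_trivg (etrans oC G1)) big_set1 order1 divr1 m_ge1.
have p_pr : prime (pdiv #|G|) by rewrite pdiv_prime // ltn_neqAle eq_sym ntG /=.
set p := pdiv #|G| in p_pr.
have oP : #|'O_p(G)%g| = (p ^ logn p #|G|)%N by rewrite card_pcore_nil ?p_part.
have oQ : #|'O_p(C)%g| = (p ^ logn p #|G|)%N.
  by rewrite card_pcore_nil ?p_part ?oC.
have oK : #|'O_p^'(C)%g| = #|'O_p^'(G)%g| by rewrite !card_pcore_nil ?oC.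
rewrite (m_pcoreC p nilC) (m_pcoreC p nilG).
apply: ler_pM; try exact: le_trans ler01 (m_ge1 _).
  rewrite (m_cyclic_pgroup p_pr (cyclicS (pcore_sub _ _) cycC) oQ).
  exact: m_pgroup_ge.
apply: IH => //; last 2 first.
- exact: nilpotentS (pcore_sub _ _) nilG.
- exact: cyclicS (pcore_sub _ _) cycC.
apply: leq_trans le_Gn; rewrite -(dprod_card (nilpotent_pcoreC p nilG)) oP.
rewrite ltn_Pmull ?cardG_gt0 // -[1%N](exp1n (logn p #|G|)) ltn_exp2r ?prime_gt1 //.
by rewrite logn_gt0 mem_primes p_pr cardG_gt0 pdiv_dvd.
Qed.

(** * The comparison *)

(** The left factor is 1 + 1 / (2 + t), decreasing in t. For p = 2 the worst
    case is t = k + 2, where the claim reads (5 + k) / 2 <= k + 5 / 2. For odd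
    p the worst case is t = 0, and the bound 3 / 2 follows from p >= 3. *)
Lemma pgroup_ratio (p k t : nat) (q := p%:R : rat) :
    prime p -> (p = 2 -> k.+2 <= t)%N ->
  (3 + t%:R) / (2 + t%:R) * (1 + k.+2%:R * (1 - q^-1))
    <= 1 + k.+1%:R * (q - 1) + (1 - q^-1).
Proof.
move=> p_pr; have t_ge0 : 0 <= t%:R :> rat by [].
have k_ge0 : 0 <= k%:R :> rat by [].
have ->: (3 + t%:R) / (2 + t%:R) = 1 + (2 + t%:R)^-1 :> rat by field; lra.
have -> : k.+2%:R = k%:R + 2 :> rat by rewrite -addn2 natrD.
have -> : k.+1%:R = k%:R + 1 :> rat by rewrite -addn1 natrD.
have [p2 /(_ p2) le_kt | p_odd _] := even_prime p_pr.
  have le_k2t : k%:R + 2 <= t%:R :> rat by rewrite -natrD addn2 ler_nat.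
  rewrite /q p2.
  set r := (2 + t%:R)^-1.
  have: r * (4 + k%:R) <= 1.
    by rewrite mulrC ler_pdivrMr; lra.
  lra.
have q_ge3 : 3 <= q by rewrite ler_nat odd_prime_gt2.
have le_r : (2 + t%:R)^-1 <= 2^-1 :> rat by rewrite lef_pV2 ?posrE; lra.
have q'_ge0 : 0 <= 1 - q^-1 by rewrite subr_ge0 invf_le1; lra.
have [q'_gt0 q'_le] : 0 < q^-1 /\ q^-1 <= 3^-1.
  by rewrite invr_gt0 lef_pV2 ?posrE; lra.
apply: (le_trans (y := (1 + 2^-1) * (1 + (k%:R + 2) * (1 - q^-1)))).
  by rewrite ler_wpM2r ?lerD2l // addr_ge0 // mulr_ge0 // addr_ge0.
have le_3w : 3 * (1 - q^-1) <= q - 1.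
  have ->: q - 1 = q * (1 - q^-1) by field; lra.
  by rewrite ler_wpM2r.
have : (k%:R + 1) * (3 * (1 - q^-1)) <= (k%:R + 1) * (q - 1).
  by rewrite ler_wpM2l // addr_ge0.
have : 0 <= k%:R * (1 - q^-1) by rewrite mulr_ge0.
by lra.
Qed.

Theorem theorem1p2 (gT : finGroupType) (G : {group gT}) (n t l : nat)
    (abG : abelian G) (ncycG : ~~ cyclic G) (oG : #|G| = n)
    (n_eq : n = (2 ^ t * l)%N) (co2l : coprime 2 l) :
  m G >= (3 + t%:R) / (2 + t%:R) * m (Zp n).
Proof.
have nilG : nilpotent G := abelian_nil abG.
have [oZ cycZ] : #|Zp n| = n /\ cyclic (Zp n).
  rewrite card_Zp -?oG ?cardG_gt0 //; split=> //.
  rewrite /Zp oG -oG cardG_gt1.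
  case: eqP => [G1 | _]; first by rewrite G1 cyclic1 in ncycG.
  by apply/cyclicP; exists Zp1; apply: Zp_cycle.
have nilZ : nilpotent (Zp n) := abelian_nil (cyclic_abelian cycZ).
have [p p_pr rGp] := rank_witness G.
(* The rank of G is at least 2 and is attained at p, hence also in the Sylow
   p-subgroup 'O_p(G); E is a subgroup of rank 2 there. *)
have: (2 <= 'r_p(G)%g)%N.
  by rewrite -rGp ltnNge -(abelian_rank1_cyclic abG).
rewrite -(p_rank_Sylow (nilpotent_pcore_Hall p nilG)).
case/p_rank_geP=> E /pnElemPcard[sEP abE oE].
have ncycE : ~~ cyclic E by rewrite (abelem_cyclic abE) oE pfactorK.
have oP : #|'O_p(G)%g| = (p ^ logn p n)%N by rewrite card_pcore_nil ?p_part ?oG.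
have oQ : #|'O_p(Zp n)%g| = (p ^ logn p n)%N.
  by rewrite card_pcore_nil // p_part oZ.
have [k def_k] : exists k, logn p n = k.+2.
  have: (1 < logn p n)%N.
    rewrite -(leq_exp2l _ _ (prime_gt1 p_pr)) -oP -oE.
    exact: subset_leq_card.
  by case: (logn p n) => [|[|k]] // _; exists k.
rewrite def_k in oP oQ.
have ratio_ge0 : 0 <= (3 + t%:R) / (2 + t%:R) :> rat.
  by rewrite divr_ge0 ?addr_ge0.
rewrite (m_pcoreC p nilG) (m_pcoreC p nilZ) mulrA.
apply: ler_pM; last 1 first.
- apply: m_nilpotent_ge_cyclic.
  + exact: nilpotentS (pcore_sub _ _) nilG.
  + exact: cyclicS (pcore_sub _ _) cycZ.
  by rewrite !card_pcore_nil // oZ oG.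
- by rewrite mulr_ge0 // (le_trans ler01) ?m_ge1.
- by rewrite (le_trans ler01) ?m_ge1.
rewrite (m_cyclic_pgroup p_pr (cyclicS (pcore_sub _ _) cycZ) oQ).
apply: le_trans (m_noncyclic_pgroup_ge p_pr sEP ncycE oE oP).
apply: pgroup_ratio => // p2.
(* Oddness of l makes t the exact exponent of 2 in n. *)
by rewrite -def_k p2 n_eq mulnC logn_Gauss // pfactorK.
Qed.
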